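(* Let $G=(V,E)$ be a locally finite weighted graph satisfying the $CD\psi(n,-K)$ condition with $K\geq0$, where $\psi\in C^1(0,+\infty)$ is a concave function with $\psi'(1)>0$ and $H_\psi<\infty$. Then for any $0<t<s$ and any $x,y,z\in V$, the heat kernel $p$ satisfies $$p(t,x,y)\leq p(s,x,z)\left(\frac st\right)^{\frac n{2\psi'(1)}}\exp\left(\frac{Kn(s-t)}{4\psi'(1)}+\frac{\psi'(1)H_\psi\mu_{\max}(3+2Ks)\,d^2(y,z)}{3w_{\min}(s-t)}\right).$$
   Context: A locally finite weighted graph $G=(V,E)$ here means a connected graph in which every vertex has finitely many neighbours, with a vertex measure $\mu:V\to(0,\infty)$ and symmetric edge weights $w_{xy}=w_{yx}>0$ for $x\sim y$ (adjacent), such that $D_\mu:=\sup_{x}\frac{\deg(x)}{\mu(x)}<\infty$ where $\deg(x)=\sum_{y\sim x}w_{xy}$, $\mu_{\max}:=\sup_x\mu(x)<\infty$, and $w_{\min}:=\inf_{x\sim y}w_{xy}>0$. $d(x,y)$ is the combinatorial graph distance (minimal number of edges in a path). For $f:V\to\mathbb R$, $\Delta f(x)=\frac1{\mu(x)}\sum_{y\sim x}w_{xy}(f(y)-f(x))$. $\Delta$ is bounded on $\ell^\infty(V)$ (bounded functions, sup norm), and $P_t=e^{t\Delta}=\sum_{k\ge0}\frac{t^k}{k!}\Delta^k$, $t\ge0$. The heat kernel is $p(t,x,y)=\frac1{\mu(y)}P_t\mathbf 1_{\{y\}}(x)$. For $\psi\in C^1(0,\infty)$ and $f:V\to(0,\infty)$: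 $(\Delta^\psi f)(x)=\Delta\left[\psi\left(\frac{f}{f(x)}\right)\right](x)$. For concave $\psi$ put $\overline\psi(s)=\psi'(1)(s-1)-[\psi(s)-\psi(1)]$ and $\Gamma^\psi(f):=\Delta^{\overline\psi}f$, i.e. $\Gamma^\psi(f)(x)=\frac1{\mu(x)}\sum_{y\sim x}w_{xy}\overline\psi\left(\frac{f(y)}{f(x)}\right)$. Further $$\Omega^\psi f(x)=\Delta\left[\psi'\left(\frac f{f(x)}\right)\frac f{f(x)}\left(\frac{\Delta f}{f}-\frac{\Delta f(x)}{f(x)}\right)\right](x),$$ $$2\Gamma_2^\psi(f)=\Omega^\psi(f)+\frac{\Delta f\cdot\Delta^\psi f}{f}-\frac{\Delta(f\cdot\Delta^\psi f)}{f}.$$ For $n>0$ and $\kappa\in\mathbb R$, $G$ satisfies $CD\psi(n,\kappa)$ if for every $f:V\to(0,\infty)$, pointwise on $V$, $\Gamma_2^\psi(f)\ge\frac1n(\Delta^\psi f)^2+\kappa\,\Gamma^\psi(f)$. Constant of $\psi$: $H_\psi:=\sup_{s>1}\frac{(\log s)^2}{\overline\psi(s)}$. *)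

(* Defs.v *)
From mathcomp Require Import all_boot all_order all_algebra.
From mathcomp Require Import all_classical all_reals all_analysis.
Import Order.TTheory GRing.Theory Num.Theory.
Import numFieldNormedType.Exports.

Set Implicit Arguments.
Unset Strict Implicit.
Unset Printing Implicit Defensive.

Local Open Scope classical_set_scope.
Local Open Scope ring_scope.

(* [walk e n x y]: there is an [e]-path with [n] edges from [x] to [y]. *)
Definition walk (V : eqType) (e : rel V) (n : nat) (x y : V) : bool :=
  `[< exists p : seq V, [/\ size p = n, path e x p & last x p = y] >].

(* Loops are not excluded: they cancel in the Laplacian.  The values of
   [weight] outside the edges are irrelevant. *)
Record wgraph (R : realType) (V : choiceType) := WGraph {
  adj : rel V;
  mu : V -> R;
  weight : V -> V -> R;
  adj_sym : symmetric adj;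
  adj_finite : forall x, finite_set [set y | adj x y];
  adj_connected : forall x y, exists n, walk adj n x y;
  mu_gt0 : forall x, 0 < mu x;
  weight_sym : forall x y, adj x y -> weight x y = weight y x;
  weight_gt0 : forall x y, adj x y -> 0 < weight x y }.

Section graph.
Variables (R : realType) (V : choiceType) (G : wgraph R V).
Implicit Types (f : V -> R) (psi : R -> R).

Definition dist (x y : V) : nat := ex_minn (adj_connected G x y).

Definition deg (x : V) : R := \sum_(y \in [set y | adj G x y]) weight G x y.

Definition D_mu : \bar R := ereal_sup [set (deg x / mu G x)%:E | x in setT].

Definition mu_max : \bar R := ereal_sup [set (mu G x)%:E | x in setT].

(* equal to +oo if there is no edge *)
Definition w_min : \bar R :=
  ereal_inf [set (weight G e.1 e.2)%:E | e in [set e : V * V | adj G e.1 e.2]].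

Definition laplacian f (x : V) : R :=
  (mu G x)^-1 * \sum_(y \in [set y | adj G x y]) weight G x y * (f y - f x).

(* The exponential series of [t * laplacian], evaluated at [x].  When
   [D_mu < +oo] and [f] is bounded the series converges uniformly on [V], so
   its sum in the sup norm is the pointwise one. *)
Definition heat_semigroup (t : R) f (x : V) : R :=
  limn (series (fun k => t ^+ k / k`!%:R * iter k laplacian f x)).

Definition heat_kernel (t : R) (x y : V) : R :=
  (mu G y)^-1 * heat_semigroup t \1_[set y] x.

Definition laplacian_psi psi f (x : V) : R :=
  laplacian (fun y => psi (f y / f x)) x.

Definition psibar psi (s : R) : R :=
  derive1 psi 1 * (s - 1) - (psi s - psi 1).

Definition Gamma_psi psi f (x : V) : R := laplacian_psi (psibar psi) f x.

Definition Omega_psi psi f (x : V) : R :=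
  laplacian (fun y => derive1 psi (f y / f x) * (f y / f x) *
    (laplacian f y / f y - laplacian f x / f x)) x.

Definition Gamma2_psi psi f (x : V) : R :=
  2^-1 * (Omega_psi psi f x
          + laplacian f x * laplacian_psi psi f x / f x
          - laplacian (fun y => f y * laplacian_psi psi f y) x / f x).

Definition CDpsi psi (n kappa : R) : Prop :=
  forall f, (forall x, 0 < f x) -> forall x,
    n^-1 * laplacian_psi psi f x ^+ 2 + kappa * Gamma_psi psi f x
      <= Gamma2_psi psi f x.

End graph.

(* The quotient is taken in [\bar R], where [0^-1 = +oo], so that [H_psi] is
   +oo as soon as [psibar psi] vanishes at some [s > 1]. *)
Definition H_psi (R : realType) (psi : R -> R) : \bar R :=
  ereal_sup [set ((ln s ^+ 2)%:E / (psibar psi s)%:E)%E | s in `]1, +oo[].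

Definition C1_pos (R : realType) (psi : R -> R) : Prop :=
  forall s : R, 0 < s -> derivable psi s 1 /\ {for s, continuous (derive1 psi)}.

Definition concave_pos (R : realType) (psi : R -> R) : Prop :=
  convex_function (`]0, +oo[ : set (convex_lmodType R^o)) (fun s => - psi s).

(* Main.v *)
(* Let u be a positive bounded solution of the heat equation, with P = laplacian_psi u and
   L = laplacian u.  The operators are built so that
   2 u Gamma2_psi(u) = (d/dt - laplacian)(u P), and Gamma_psi(u) = psi'(1) L / u - P.
   Following Li and Xu, put
     v = t^2 u P + (2 K t^3 / 3) psi'(1) L + (n / 2) (t + K t^2 + K^2 t^3 / 3) u.
   By the curvature condition, (d/dt - laplacian) v is at least a positive multiple of a
   square, and v vanishes at t = 0.  As the Laplacian is bounded, a maximum principle gives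
   v >= 0, which is a Li-Yau inequality
     psi'(1) d/dt (log u) >= Gamma_psi(u) / (1 + 2 K t / 3) - n / (2 t) - n K / 4.
   Since Gamma_psi(u)(z) >= w_min / (mu_max H_psi) (log (u(y) / u(z)))^2 when u(y) > u(z)
   and y ~ z, a Riccati comparison gives the Harnack inequality along one edge.  Splitting
   [t, s] into d(y, z) equal parts gives it along a geodesic.  It is applied to
   u = p(., x, .) + eps: the constant keeps u(y) / u(x) in a compact subset of
   (0, +oo), which makes v bounded below however psi behaves at 0 and +oo. *)
Require Import Defs.
From mathcomp Require Import all_boot all_order all_algebra.
From mathcomp Require Import all_classical all_reals all_analysis.
From mathcomp Require Import ring lra.
Import Order.TTheory GRing.Theory Num.Theory.
Import numFieldNormedType.Exports.
Set Implicit Arguments.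
Unset Strict Implicit.
Unset Printing Implicit Defensive.
Local Open Scope classical_set_scope.
Local Open Scope ring_scope.

(** * Differentiation rules for real functions, and monotonicity from a nonnegative derivative *)

Section calculus.
Context {R : realType}.
Implicit Types f g : R -> R.

Lemma is_derive_seq_sum (I : Type) (r : seq I) (f : I -> R -> R) (df : I -> R)
    (t : R) : (forall i, is_derive t 1 (f i) (df i)) ->
  is_derive t 1 (fun s => \sum_(i <- r) f i s) (\sum_(i <- r) df i).
Proof.
move=> fdf; elim: r => [|i r IH].
  rewrite big_nil (_ : (fun _ => _) = cst 0); first exact: is_derive_cst.
  by apply/funext => s; rewrite big_nil.
rewrite big_cons (_ : (fun _ => _) = f i \+ fun s => \sum_(j <- r) f j s).
  exact: is_deriveD.
by apply/funext => s; rewrite big_cons.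
Qed.

Lemma is_derive_mul f g (t df dg : R) : is_derive t 1 f df -> is_derive t 1 g dg ->
  is_derive t 1 (fun s => f s * g s) (df * g t + f t * dg).
Proof.
move=> fdf gdg; apply: is_derive_eq (is_deriveM fdf gdg) _.
by rewrite addrC /GRing.scale /= [g t * _]mulrC.
Qed.

Lemma is_derive_add f g (t df dg : R) : is_derive t 1 f df -> is_derive t 1 g dg ->
  is_derive t 1 (fun s => f s + g s) (df + dg).
Proof. exact: is_deriveD. Qed.

Lemma is_derive_cmul f (c t df : R) : is_derive t 1 f df ->
  is_derive t 1 (fun s => c * f s) (c * df).
Proof. exact: is_deriveZ. Qed.

Lemma is_derive_expn f (n : nat) (t df : R) : is_derive t 1 f df ->
  is_derive t 1 (fun s => f s ^+ n) (n%:R * f t ^+ n.-1 * df).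
Proof. by move=> fdf; have := is_deriveX n fdf; rewrite exprfctE. Qed.

Lemma is_derive_div f g (t df dg : R) : g t != 0 ->
  is_derive t 1 f df -> is_derive t 1 g dg ->
  is_derive t 1 (fun s => f s / g s) (df / g t - f t / g t * (dg / g t)).
Proof.
move=> gt0 fdf gdg.
apply: is_derive_eq (is_derive_mul fdf (is_deriveV gt0 gdg)) _.
by rewrite /GRing.scale /=; field.
Qed.

Lemma is_derive_ge0_le f df (a b : R) : a <= b ->
  (forall t, a <= t <= b -> is_derive t 1 f (df t)) ->
  (forall t, a <= t <= b -> 0 <= df t) -> f a <= f b.
Proof.
move=> ab fdf df0.
have fdf' t : t \in `]a, b[ -> is_derive t 1 f (df t).
  by rewrite in_itv /= => /andP[at_ tb]; apply: fdf; rewrite !ltW.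
have fc : {within `[a, b], continuous f}.
  apply: derivable_within_continuous => t tab.
  by have [] := fdf t; rewrite // in_itv in tab *.
have [c cab fE] := MVT_segment ab fdf' fc.
by rewrite -subr_ge0 fE mulr_ge0 ?subr_ge0 ?df0 //; rewrite in_itv in cab.
Qed.

End calculus.

(** * The Laplacian as a finite sum, its boundedness, and a maximum principle *)

Section operator.
Context {R : realType} {V : choiceType} (G : wgraph R V).
Implicit Types (f g : V -> R) (x y : V).

Definition nbrs x : seq V := finmap.enum_fset (fset_set [set y | adj G x y]).

Definition rate x y : R := weight G x y / mu G x.

Lemma mem_nbrs x y : (y \in nbrs x) = adj G x y.
Proof. by rewrite [LHS](in_fset_set (@adj_finite R V G x)) mem_setE. Qed.

Lemma rate_gt0 x y : y \in nbrs x -> 0 < rate x y.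
Proof. by rewrite mem_nbrs => xy; rewrite divr_gt0 ?weight_gt0 ?mu_gt0. Qed.

Lemma laplacianE f x :
  laplacian G f x = \sum_(y <- nbrs x) rate x y * (f y - f x).
Proof.
rewrite /laplacian fsbig_finite /=; last exact: (@adj_finite R V G).
by rewrite mulr_sumr; apply: eq_bigr => y _; rewrite /rate mulrA [_^-1 * _]mulrC.
Qed.

Lemma laplacian_is_derive (u du : R -> V -> R) (t : R) x :
  (forall y, is_derive t 1 (u^~ y) (du t y)) ->
  is_derive t 1 (fun s => laplacian G (u s) x) (laplacian G (du t) x).
Proof.
move=> udu; under eq_fun do rewrite laplacianE.
rewrite laplacianE; exact: is_derive_seq_sum.
Qed.

Lemma laplacian_bounded_degree : (D_mu G < +oo)%E ->
  exists2 D : R, 0 <= D & forall x, \sum_(y <- nbrs x) rate x y <= D.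
Proof.
(* On an empty vertex set [D_mu] is the supremum of the empty set, and 0 serves as bound. Otherwise
   the value at [x0] shows that [D_mu] is nonnegative, hence finite. *)
move=> Dfin; have [[x0 _]|noV] := pselect (exists x : V, True); last first.
  by exists 0 => // x; case: noV; exists x.
have degE x : \sum_(y <- nbrs x) rate x y = deg G x / mu G x.
  rewrite /deg fsbig_finite /=; last exact: (@adj_finite R V G).
  by rewrite mulr_suml.
have degD x : ((deg G x / mu G x)%:E <= D_mu G)%E by apply: ereal_sup_ubound; exists x.
have deg0 : 0 <= deg G x0 / mu G x0.
  by rewrite -degE; rewrite big_seq sumr_ge0 // => y /rate_gt0 /ltW.
have D0 : (0 <= D_mu G)%E by apply: le_trans (degD x0); rewrite lee_fin.
have DE : (fine (D_mu G))%:E = D_mu G by rewrite fineK // ge0_fin_numE.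
exists (fine (D_mu G)) => [|x]; first exact: fine_ge0.
by rewrite degE -lee_fin DE.
Qed.

Section bounded.
Context (D : R) (D0 : 0 <= D) (rateD : forall x, \sum_(y <- nbrs x) rate x y <= D).

Lemma norm_laplacian_le f M : (forall x, `|f x| <= M) ->
  forall x, `|laplacian G f x| <= 2 * D * M.
Proof.
move=> fM x; rewrite laplacianE (le_trans (ler_norm_sum _ _ _)) //.
have M0 : 0 <= M by apply: le_trans (fM x).
apply: (@le_trans _ _ (\sum_(y <- nbrs x) rate x y * (2 * M))).
  rewrite big_seq [leRHS]big_seq; apply: ler_sum => y /rate_gt0 r0.
  rewrite normrM gtr0_norm // ler_wpM2l ?(ltW r0) // (le_trans (ler_normB _ _)) //.
  by rewrite mulr2n mulrDl mul1r lerD.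
by rewrite -mulr_suml [2 * D]mulrC -mulrA ler_wpM2r // mulr_ge0.
Qed.

Lemma norm_iter_laplacian_le f M k : (forall x, `|f x| <= M) ->
  forall x, `|iter k (laplacian G) f x| <= (2 * D) ^+ k * M.
Proof.
move=> fM; elim: k => [|k IH] x /=; first by rewrite expr0 mul1r.
by rewrite exprS -mulrA; apply: norm_laplacian_le.
Qed.

(* Gronwall by iteration: each pass improves the lower bound [- B] by one factor [D t / k]. *)
Lemma laplacian_max_principle (v dv : R -> V -> R) (T B : R) : 0 <= B ->
  (forall t x, 0 <= t <= T -> is_derive t 1 (v^~ x) (dv t x)) ->
  (forall t x, 0 <= t <= T -> laplacian G (v t) x <= dv t x) ->
  (forall x, 0 <= v 0 x) -> (forall t x, 0 <= t <= T -> - B <= v t x) ->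
  forall t x, 0 <= t <= T -> 0 <= v t x.
Proof.
move=> B0 vdv dvL v0 vB.
have iterB k t x : 0 <= t <= T -> 0 <= v t x + B * exp_coeff (D * t) k.
  elim: k t x => [|k IH] t x tT.
    by rewrite /exp_coeff /= expr0 fact0 divr1 mulr1 addrC -lerBlDl sub0r vB.
  have [t0 tleT] := andP tT.
  pose Dx := \sum_(y <- nbrs x) rate x y.
  (* The exponential is an integrating factor: it absorbs the diagonal term [- Dx * v s x] of the
     Laplacian, so that only the values at the neighbours remain, and the previous pass bounds these
     from below. *)
  pose h s := expR (Dx * s) * (v s x + B * exp_coeff (D * s) k.+1).
  pose dh s := expR (Dx * s) * (Dx * (v s x + B * exp_coeff (D * s) k.+1)
                                + (dv s x + B * (D * exp_coeff (D * s) k))).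
  have hdh s : 0 <= s <= T -> is_derive s 1 h (dh s).
    move=> sT; have lin c : is_derive s 1 (fun s : R => c * s) c.
      by apply: is_derive_eq (is_derive_cmul c (is_derive_id s 1)) _; rewrite mulr1.
    have expd : is_derive s 1 (fun s => expR (Dx * s)) (expR (Dx * s) * Dx).
      exact: is_derive1_comp (is_derive_expR _) (lin Dx).
    have coefd : is_derive s 1 (fun s => exp_coeff (D * s) k.+1) (D * exp_coeff (D * s) k).
      under eq_fun do rewrite /exp_coeff /= mulrC.
      apply: is_derive_eq (is_derive_cmul _ (is_derive_expn k.+1 (lin D))) _.
      rewrite /exp_coeff /= factS natrM; field.
      by rewrite pnatr_eq0 -lt0n fact_gt0 nat1r pnatr_eq0.
    apply: is_derive_eq (is_derive_mul expd (is_derive_add (vdv s x sT)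
      (is_derive_cmul B coefd))) _.
    by rewrite /dh; ring.
  have dh0 s : 0 <= s <= T -> 0 <= dh s.
    move=> sT; rewrite mulr_ge0 ?expR_ge0 //.
    have s0 : 0 <= s by case/andP: sT.
    have c0 : 0 <= exp_coeff (D * s) k.+1 by rewrite divr_ge0 ?exprn_ge0 ?mulr_ge0.
    have e0 : 0 <= exp_coeff (D * s) k by rewrite divr_ge0 ?exprn_ge0 ?mulr_ge0.
    have ve y := IH s y sT; move: c0 e0 ve.
    set c := exp_coeff _ k.+1; set e := exp_coeff _ k => c0 e0 ve; have Dx0 : 0 <= Dx.
      by rewrite /Dx big_seq sumr_ge0 // => y /rate_gt0 /ltW.
    have lapv : - (Dx * (B * e)) <= laplacian G (v s) x + Dx * v s x.
      rewrite laplacianE /Dx !mulr_suml -sumrN -big_split /= big_seq [leRHS]big_seq.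
      apply: ler_sum => y /rate_gt0 /ltW r0; rewrite -mulrDr subrK -mulrN.
      by rewrite ler_wpM2l // -subr_ge0 opprK.
    have := dvL s x sT; have := mulr_ge0 Dx0 (mulr_ge0 B0 c0).
    have := ler_wpM2r (mulr_ge0 B0 e0) (rateD x); rewrite -/Dx; lra.
  have : h 0 <= h t.
    by apply: (is_derive_ge0_le t0) => s /andP[s0 st]; [apply: hdh|apply: dh0];
      rewrite s0 (le_trans st).
  rewrite /h !mulr0 expR0 mul1r /exp_coeff /= expr0n /= mul0r mulr0 addr0.
  by move/(le_trans (v0 x)); rewrite pmulr_rge0 ?expR_gt0.
move=> t x tT.
have lim0 : v t x + B * exp_coeff (D * t) k @[k --> \oo] --> v t x + B * 0.
  apply: cvgD; first exact: cvg_cst.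
  by apply: cvgMr; exact: cvg_exp_coeff.
rewrite mulr0 addr0 in lim0.
rewrite -(cvg_lim _ lim0) //; apply: limr_ge; first by apply/cvg_ex; eexists; exact: lim0.
by near=> k; exact: iterB.
Unshelve. all: by end_near.
Qed.

End bounded.
End operator.

(** * The heat semigroup: convergence, heat equation, positivity *)

Section heat.
Context {R : realType} {V : choiceType} (G : wgraph R V).
Context (D : R) (D0 : 0 <= D) (rateD : forall x, \sum_(y <- nbrs G x) rate G x y <= D).
Implicit Types (f g : V -> R) (x y : V) (t : R).

Lemma laplacianZ c f x : laplacian G (fun y => c * f y) x = c * laplacian G f x.
Proof.
by rewrite !laplacianE mulr_sumr; apply: eq_bigr => y _; rewrite -mulrBr mulrCA.
Qed.

Lemma laplacian_sum (I : Type) (r : seq I) (f : I -> V -> R) x :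
  laplacian G (fun y => \sum_(i <- r) f i y) x = \sum_(i <- r) laplacian G (f i) x.
Proof.
rewrite laplacianE; under [RHS]eq_bigr do rewrite laplacianE.
rewrite exchange_big; apply: eq_bigr => y _.
by rewrite -mulr_sumr sumrB.
Qed.

(** Only finitely many vertices enter at [x], so pointwise convergence suffices. This lets the
    Laplacian pass through the exponential series. *)
Lemma laplacian_cvg (f : nat -> V -> R) (l : V -> R) x :
  (forall y, f k y @[k --> \oo] --> l y) ->
  laplacian G (f k) x @[k --> \oo] --> laplacian G l x.
Proof.
move=> fl; rewrite laplacianE; under eq_fun do rewrite laplacianE.
elim: (nbrs G x : seq V) => [|y r IH].
  by rewrite big_nil (_ : (fun k => _) = cst 0) => [|]; [exact: cvg_cst|];
    apply/funext => k; rewrite big_nil.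
rewrite big_cons (_ : (fun k => _) = fun k => rate G x y * (f k y - f k x)
    + \sum_(z <- r) rate G x z * (f k z - f k x)).
  by apply: cvgD IH; apply: cvgMr; apply: cvgB.
by apply/funext => k; rewrite big_cons.
Qed.

Definition heat_coeff f x (k : nat) : R := k`!%:R^-1 * iter k (laplacian G) f x.

Lemma heat_semigroupE t f x :
  heat_semigroup G t f x = limn (pseries (heat_coeff f x) t).
Proof.
rewrite /heat_semigroup /pseries; congr (limn (series _)); apply/funext => k.
by rewrite /heat_coeff /=; ring.
Qed.

(** Termwise differentiation in time gives another heat series, so the convergence conditions of
    [pseries_snd_diffs] all become instances of [cvg_heat]. *)
Lemma pseries_diffs_heat f x :
  pseries_diffs (heat_coeff f x) = heat_coeff (laplacian G f) x.
Proof.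
apply/funext => k; rewrite /pseries_diffs /heat_coeff factS natrM invfM iterSr.
by rewrite !mulrA mulfV ?mul1r // pnatr_eq0.
Qed.

Section bounded_data.
Variables (f : V -> R) (M : R).
Hypothesis fM : forall x, `|f x| <= M.

Lemma norm_heat_term_le x t k :
  `|heat_coeff f x k * t ^+ k| <= M * exp_coeff (2 * D * `|t|) k.
Proof.
have : `|iter k (laplacian G) f x| * (`|t| ^+ k / k`!%:R)
       <= (2 * D) ^+ k * M * (`|t| ^+ k / k`!%:R).
  by rewrite ler_wpM2r ?norm_iter_laplacian_le // divr_ge0 ?exprn_ge0.
rewrite /heat_coeff /exp_coeff /= !normrM normfV normrX normr_nat [(_ * `|t|) ^+ k]exprMn.
by congr (_ <= _); ring.
Qed.

Lemma cvg_heat_norm x t : cvgn [normed pseries (heat_coeff f x) t].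
Proof.
have M0 : 0 <= M by apply: le_trans (fM x).
apply: (@series_le_cvg _ _ (M *: exp_coeff (2 * D * `|t|))) => [k|k|k|] //=.
- by rewrite mulr_ge0 // exp_coeff_ge0 // !mulr_ge0.
- exact: norm_heat_term_le.
- by apply: is_cvg_seriesZ; exact: is_cvg_series_exp_coeff.
Qed.

Lemma cvg_heat x t : cvgn (pseries (heat_coeff f x) t).
Proof. by apply: normed_cvg; exact: cvg_heat_norm. Qed.

Lemma norm_heat_le x t : `|heat_semigroup G t f x| <= M * expR (2 * D * `|t|).
Proof.
have M0 : 0 <= M by apply: le_trans (fM x).
rewrite heat_semigroupE.
apply: le_trans (lim_series_norm (@cvg_heat_norm x t)) _.
have -> : M * expR (2 * D * `|t|) = limn (series (M *: exp_coeff (2 * D * `|t|))).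
  rewrite -[LHS](limZl_tmp M (@is_cvg_series_exp_coeff _ (2 * D * `|t|))).
  by congr (limn _); apply/funext => n; rewrite /series /= -scaler_sumr.
apply: lim_series_le => [||k].
- exact: cvg_heat_norm.
- by apply: is_cvg_seriesZ; exact: is_cvg_series_exp_coeff.
- exact: norm_heat_term_le.
Qed.

End bounded_data.

Lemma laplacian_heat f (M : R) x t : (forall x, `|f x| <= M) ->
  laplacian G (heat_semigroup G t f) x = heat_semigroup G t (laplacian G f) x.
Proof.
move=> fM; apply/esym/cvg_lim => //.
have := @laplacian_cvg (fun n y => pseries (heat_coeff f y) t n) _ x
  (fun y => @cvg_heat f M fM y t).
rewrite (_ : (fun y => limn _) = heat_semigroup G t f); last first.
  by apply/funext => y; rewrite heat_semigroupE.
apply: cvg_trans; apply: near_eq_cvg; near=> n.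
rewrite /pseries /series /= laplacian_sum; apply: eq_bigr => k _.
rewrite -iterSr /= /heat_coeff; under eq_fun do rewrite mulrC mulrA.
by rewrite laplacianZ mulrC.
Unshelve. all: by end_near.
Qed.

Lemma heat_is_derive f (M : R) x t : (forall x, `|f x| <= M) ->
  is_derive t 1 (fun s => heat_semigroup G s f x)
    (laplacian G (heat_semigroup G t f) x).
Proof.
move=> fM; rewrite (laplacian_heat _ _ fM).
under eq_fun do rewrite heat_semigroupE.
rewrite heat_semigroupE -pseries_diffs_heat.
have LfM := norm_laplacian_le rateD fM; have LLfM := norm_laplacian_le rateD LfM.
(* The heat series converges everywhere, so any radius above [|t|] would do. *)
apply: (@pseries_snd_diffs _ _ (`|t| + 1)); rewrite ?pseries_diffs_heat.
- exact: (@cvg_heat _ _ fM).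
- exact: (@cvg_heat _ _ LfM).
- exact: (@cvg_heat _ _ LLfM).
- by rewrite [ltRHS]ger0_norm ?ltrDl // addr_ge0.
Qed.

Lemma heat0 f x : heat_semigroup G 0 f x = f x.
Proof.
rewrite heat_semigroupE; apply: lim_near_cst => //.
near=> n; have n0 : (0 < n)%N by near: n; exact: nbhs_infty_gt.
rewrite /pseries /series /= -(prednK n0) big_nat_recl // big1 ?addr0 => [|k _].
  by rewrite expr0 mulr1 /heat_coeff fact0 invr1 mul1r.
by rewrite expr0n mulr0.
Unshelve. all: by end_near.
Qed.

(** The maximum principle applies because [norm_heat_le] bounds the solution uniformly on the time
    interval. *)
Lemma heat_ge0 f (M : R) t x : (forall x, 0 <= f x <= M) -> 0 <= t -> 0 <= heat_semigroup G t f x.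
Proof.
move=> fM t0; have fM' y : `|f y| <= M by have /andP[f0 ?] := fM y; rewrite ger0_norm.
have M0 : 0 <= M by apply: le_trans (fM' x).
apply: (@laplacian_max_principle _ _ G D D0 rateD (fun s => heat_semigroup G s f)
  (fun s => laplacian G (heat_semigroup G s f)) t (M * expR (2 * D * t))) => //.
- by rewrite mulr_ge0 ?expR_ge0.
- by move=> s y _; exact: heat_is_derive.
- by move=> y; rewrite heat0; have /andP[] := fM y.
- move=> s y /andP[s0 st]; rewrite lerNl; apply: le_trans (ler_norm _) _.
  rewrite normrN (le_trans (norm_heat_le fM' y s)) // ler_wpM2l // ler_expR ger0_norm //.
  by rewrite ler_wpM2l // mulr_ge0.
- by rewrite t0 lexx.
Qed.

End heat.

(** * Symmetry of the heat kernel *)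

Section symmetry.
Context {R : realType} {V : choiceType} (G : wgraph R V).
Implicit Types (f g : V -> R) (x y : V) (t : R).

(** Dividing by [mu G y] gives the Dirac density with respect to [mu], which is symmetric in its two
    vertices. *)
Let delta y : V -> R := fun x => (mu G y)^-1 * \1_[set y] x.

Let deltaC x y : delta x y = delta y x.
Proof.
rewrite /delta !indicE !classical_sets.in_set1 eq_sym.
by case: eqVneq => [->//|_]; rewrite !mulr0.
Qed.

Let laplacian_delta x y : laplacian G (delta y) x = laplacian G (delta x) y.
Proof.
have [->//|xy] := eqVneq x y.
have deltaE a b : a != b ->
    laplacian G (delta b) a = if adj G a b then weight G a b / (mu G a * mu G b) else 0.
  move=> ab; rewrite laplacianE.
  have -> : delta b a = 0 by rewrite /delta indicE classical_sets.in_set1 (negbTE ab) mulr0.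
  under eq_bigr do rewrite subr0.
  rewrite -mem_nbrs; case: ifPn => [nab|nab].
    rewrite (bigD1_seq b) ?finmap.fset_uniq //= big1 => [|z zb].
      rewrite /delta indicE classical_sets.in_set1 eqxx mulr1 addr0 /rate; field.
      by rewrite !gt_eqF ?mu_gt0.
    by rewrite /delta indicE classical_sets.in_set1 (negbTE zb) !mulr0.
  rewrite big_seq big1 // => z; have [->|zb] := eqVneq z b.
    by rewrite (negbTE nab).
  by rewrite /delta indicE classical_sets.in_set1 (negbTE zb) !mulr0.
rewrite !deltaE // 1?eq_sym // adj_sym.
by case: ifP => // yx; rewrite mulrC (weight_sym yx) [RHS]mulrC [mu _ _ * _]mulrC.
Qed.

Let laplacian_comm (F : V -> V -> R) x y :
  laplacian G (fun a => laplacian G (F a) y) x =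
  laplacian G (fun b => laplacian G (F^~ b) x) y.
Proof.
rewrite !laplacianE; under eq_bigr do rewrite !laplacianE -sumrB mulr_sumr.
under [RHS]eq_bigr do rewrite !laplacianE -sumrB mulr_sumr.
rewrite exchange_big; apply: eq_bigr => a _; apply: eq_bigr => b _; ring.
Qed.

(** The two claims need a joint induction. The second moves one Laplacian from the first variable of
    the [k]-th kernel to the other, which gives symmetry at [k.+1]; it propagates because Laplacians
    in different variables commute. *)
Let iter_delta k : (forall x y, iter k (laplacian G) (delta y) x
                                = iter k (laplacian G) (delta x) y) /\
  (forall x y, laplacian G (fun z => iter k (laplacian G) (delta y) z) x
               = laplacian G (fun z => iter k (laplacian G) (delta z) x) y).
Proof.
elim: k => [|k [IH1 IH2]]; split => x y /=.
- exact: deltaC.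
- under [in RHS]eq_fun do rewrite deltaC.
  exact: laplacian_delta.
- by rewrite [LHS]IH2; congr (laplacian G _ y); apply/funext => z; rewrite IH1.
- rewrite -[RHS]laplacian_comm; congr (laplacian G _ x); apply/funext => z.
  exact: IH2.
Qed.

Lemma heat_kernelE (D : R) t x y : (forall x, \sum_(y <- nbrs G x) rate G x y <= D) ->
  0 <= D -> heat_kernel G t x y = heat_semigroup G t (fun z => (mu G y)^-1 * \1_[set y] z) x.
Proof.
move=> rateD D0; rewrite !heat_semigroupE /heat_kernel heat_semigroupE.
have ind1 z : `|\1_[set y] z : R| <= 1.
  by rewrite indicE; case: (_ \in _); rewrite ?normr0 ?normr1.
rewrite -[LHS](limZl_tmp _ (@cvg_heat _ _ G D D0 rateD _ _ ind1 x t)).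
congr (limn _); apply/funext => n; rewrite /pseries /series /= [LHS]scaler_sumr.
apply: eq_bigr => k _; rewrite /heat_coeff /GRing.scale /=.
suff -> : iter k (laplacian G) (fun z => (mu G y)^-1 * \1_[set y] z)
    = fun z => (mu G y)^-1 * iter k (laplacian G) \1_[set y] z by ring.
elim: k => //= k ->; apply/funext => z; exact: laplacianZ.
Qed.

Lemma heat_kernelC (D : R) t x y : (forall x, \sum_(y <- nbrs G x) rate G x y <= D) ->
  0 <= D -> heat_kernel G t x y = heat_kernel G t y x.
Proof.
move=> rateD D0; rewrite !(heat_kernelE _ _ _ rateD D0) !heat_semigroupE.
congr (limn (pseries _ t)); apply/funext => k; rewrite /heat_coeff.
by have [-> _] := iter_delta k.
Qed.

End symmetry.

(** * Consequences of concavity and of the finiteness of [H_psi] *)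

Section psi.
Context {R : realType} (psi : R -> R).
Hypothesis (psiC1 : C1_pos psi) (psi_conc : concave_pos psi).

Lemma C1_pos_is_derive (s : R) : 0 < s -> is_derive s 1 psi (derive1 psi s).
Proof. by move=> s0; have [ps _] := psiC1 s0; rewrite derive1E; exact: derivableP. Qed.

Lemma concave_pos_le (a b h : R) : 0 < a -> 0 < b -> 0 <= h <= 1 ->
  h * psi a + (1 - h) * psi b <= psi (h * a + (1 - h) * b).
Proof.
move=> a0 b0 /andP[h0 h1].
have ain x : 0 < x -> (x : convex_lmodType R^o) \in [set` `]0, +oo[].
  by move=> x0; rewrite inE /= in_itv /= x0.
have : - psi (h * a + (1 - h) * b) <= h * - psi a + (1 - h) * - psi b.
  exact: (@psi_conc (Itv01 h0 h1) a b (ain a a0) (ain b b0)).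
by rewrite !mulrN -opprD lerN2.
Qed.

(** A concave function lies below its tangent at 1. With [F] the excess of [psi] over its chord from
    1 to [s], shifted by [psi 1], concavity gives [F h >= F 0] on [0, 1], and [psibar psi s] is the
    derivative of [F] at 0. *)
Lemma psibar_ge0 (s : R) : 0 < s -> 0 <= psibar psi s.
Proof.
move=> s0.
pose F h := psi (1 + (s - 1) * h) + (psi 1 - psi s) * h.
have lind (c h : R) : is_derive h 1 (fun h => c * h) c.
  by apply: is_derive_eq (is_derive_cmul c (is_derive_id h 1)) _; rewrite mulr1.
have Fd : is_derive (0 : R) 1 F (psibar psi s).
  have lin1 : is_derive (0 : R) 1 (fun h => 1 + (s - 1) * h) (s - 1).
    apply: is_derive_eq (@is_derive_add R (cst 1) _ _ _ _ (is_derive_cst _ _ _) (lind _ _)) _.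
    by rewrite add0r.
  have psid : is_derive (1 + (s - 1) * 0) 1 psi (derive1 psi 1).
    by rewrite mulr0 addr0; exact: C1_pos_is_derive.
  have Fd := is_derive_add
    (@is_derive1_comp R psi (fun h => 1 + (s - 1) * h) 0 _ _ psid lin1)
    (lind (psi 1 - psi s) 0).
  apply: is_derive_eq Fd _.
  by rewrite /psibar; ring.
have F0 : F 0 = psi 1 by rewrite /F !mulr0 !addr0.
have [Fder <-] := Fd.
rewrite -derive1E /derive1.
have Fcvg : cvg (h^-1 *: (F (h + 0) - F 0) @[h --> (0 : R)^']).
  rewrite (_ : (fun h => _) = fun h : R => h^-1 *: ((F \o shift 0) (h *: 1) - F 0)) //.
  by apply/funext => h /=; rewrite /GRing.scale /= mulr1.
(* The chord inequality only speaks of [h > 0], so the derivative is read as a limit from the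
   right. *)
rewrite (cvg_at_rightE _ _ Fcvg).
apply: limr_ge; first by apply/cvg_ex; eexists; apply: cvg_dnbhs_at_right; exact: Fcvg.
near=> h.
have h0 : 0 < h by near: h; exact: nbhs_right_gt.
have h1 : h <= 1 by near: h; exact: nbhs_right_le.
rewrite F0 addr0 /GRing.scale /= mulr_ge0 ?invr_ge0 ?(ltW h0) //.
have := @concave_pos_le s 1 h s0 ltr01; rewrite (ltW h0) h1 => /(_ isT).
rewrite (_ : h * s + (1 - h) * 1 = 1 + (s - 1) * h); last by ring.
rewrite /F; lra.
Unshelve. all: end_near.
Qed.

Lemma psi_lower_bound (a b : R) : 0 < a -> a <= b ->
  exists m, forall s, a <= s <= b -> m <= psi s.
Proof.
move=> a0 ab.
have c : {within `[a, b], continuous psi}.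
  apply: derivable_within_continuous => s; rewrite in_itv /= => /andP[as_ _].
  by have [] := C1_pos_is_derive (lt_le_trans a0 as_).
have [m _ hm] := EVT_min ab c.
by exists (psi m) => s sab; apply: hm; rewrite in_itv.
Qed.

Lemma H_psi_bound : (H_psi psi < +oo)%E ->
  0 < fine (H_psi psi) /\
  forall s, 1 < s -> ln s ^+ 2 <= fine (H_psi psi) * psibar psi s.
Proof.
move=> Hfin.
have ubH s : 1 < s -> ((ln s ^+ 2)%:E / (psibar psi s)%:E <= H_psi psi)%E.
  by move=> s1; apply: ereal_sup_ubound; exists s => //=; rewrite in_itv /= s1.
(* At a zero of [psibar psi] the quotient would be +oo, since [ln s] is positive. *)
have psib0 s : 1 < s -> 0 < psibar psi s.
  move=> s1; rewrite lt_def psibar_ge0 ?andbT ?(lt_trans ltr01) //; apply/eqP => p0.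
  have := ubH s s1; rewrite p0 inve0 gt0_muley ?lte_fin ?exprn_gt0 ?ln_gt0 //.
  by rewrite leye_eq => /eqP HE; rewrite HE ltxx in Hfin.
have ubH' s : 1 < s -> ((ln s ^+ 2 / psibar psi s)%:E <= H_psi psi)%E.
  by move=> s1; have := ubH s s1; rewrite inver gt_eqF ?psib0 // -EFinM.
have pos s : 1 < s -> 0 < ln s ^+ 2 / psibar psi s.
  by move=> s1; rewrite divr_gt0 ?psib0 // exprn_gt0 // ln_gt0.
have H0 : (0 < H_psi psi)%E.
  have two : (1 : R) < 2 by rewrite ltr1n.
  by apply: lt_le_trans (ubH' 2 two); rewrite lte_fin pos.
have HE : (fine (H_psi psi))%:E = H_psi psi by rewrite fineK // gt0_fin_numE.
split=> [|s s1]; first by rewrite fine_gt0 // H0.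
by rewrite -ler_pdivrMr ?psib0 // -lee_fin HE ubH'.
Qed.

End psi.

(** * The Li-Yau inequality for positive bounded solutions *)

Section li_yau.
Context {R : realType} {V : choiceType} (G : wgraph R V) (psi : R -> R).
Hypothesis psiC1 : C1_pos psi.
Local Notation d := (derive1 psi 1).
Implicit Types (f g : V -> R) (x y : V).

Lemma Gamma_psi_sum f x : 0 < f x ->
  Gamma_psi G psi f x = \sum_(y <- nbrs G x) rate G x y * psibar psi (f y / f x).
Proof.
move=> fx0; rewrite /Gamma_psi /laplacian_psi laplacianE.
by under eq_bigr do rewrite mulfV ?gt_eqF // {2}/psibar !subrr mulr0 subrr subr0.
Qed.

Lemma Gamma_psiE f x : 0 < f x ->
  Gamma_psi G psi f x = d * (laplacian G f x / f x) - laplacian_psi G psi f x.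
Proof.
move=> fx0; rewrite Gamma_psi_sum // /laplacian_psi !laplacianE mulr_suml mulr_sumr -sumrB.
apply: eq_bigr => y _; rewrite /psibar mulfV ?gt_eqF //; field.
by rewrite gt_eqF.
Qed.

Lemma laplacian_comb3 (a b c : R) f g h x :
  laplacian G (fun y => a * f y + b * g y + c * h y) x
  = a * laplacian G f x + b * laplacian G g x + c * laplacian G h x.
Proof.
rewrite !laplacianE !mulr_sumr -!big_split /=; apply: eq_bigr => y _; ring.
Qed.

Variables (D : R) (n K T eps M : R) (u : R -> V -> R).
Hypothesis (D0 : 0 <= D) (rateD : forall x, \sum_(y <- nbrs G x) rate G x y <= D).
Hypothesis (d0 : 0 < d) (n0 : 0 < n) (K0 : 0 <= K) (CD : CDpsi G psi n (- K)).
Hypothesis (eps0 : 0 < eps).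
Hypothesis (heat_u : forall (t : R) x, is_derive t 1 (u^~ x) (laplacian G (u t) x)).
Hypothesis (u_ge : forall t x, 0 <= t <= T -> eps <= u t x).
Hypothesis (u_le : forall t x, 0 <= t <= T -> u t x <= M).

Let u_gt0 (t : R) x : 0 <= t <= T -> 0 < u t x.
Proof. by move=> tT; apply: lt_le_trans (u_ge x tT). Qed.

(** Along the heat flow the ratio r = u(y) / u(x) has derivative r times the difference of
    [laplacian u / u] at [y] and [x]. This is the factor built into [Omega_psi]. *)
Lemma laplacian_psi_is_derive (t : R) x : 0 <= t <= T ->
  is_derive t 1 (fun s => laplacian_psi G psi (u s) x) (Omega_psi G psi (u t) x).
Proof.
move=> tT; pose du s y := derive1 psi (u s y / u s x) * (u s y / u s x) *
    (laplacian G (u s) y / u s y - laplacian G (u s) x / u s x).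
apply: (@laplacian_is_derive _ _ G (fun s y => psi (u s y / u s x)) du) => y.
have ux0 := u_gt0 x tT; have uy0 := u_gt0 y tT.
have psid := C1_pos_is_derive psiC1 (divr_gt0 uy0 ux0).
have ratd := is_derive_div (lt0r_neq0 ux0) (heat_u t y) (heat_u t x).
apply: is_derive_eq (@is_derive1_comp R psi (fun s => u s y / u s x) t _ _ psid ratd) _.
by rewrite /du; field; rewrite !gt_eqF.
Qed.

(** The polynomial in the last term is the primitive of (1 + K t)^2. The coefficient of the
    Laplacian has derivative 2 K psi'(1) t^2, which cancels the Laplacian term produced by
    [- K * Gamma_psi]. *)
Let v (t : R) x : R := t ^+ 2 * (u t x * laplacian_psi G psi (u t) x)
  + 2 * K / 3 * d * t ^+ 3 * laplacian G (u t) x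
  + n / 2 * (t + K * t ^+ 2 + K ^+ 2 / 3 * t ^+ 3) * u t x.

Let dv (t : R) x : R :=
  2 * t * (u t x * laplacian_psi G psi (u t) x)
  + t ^+ 2 * (laplacian G (u t) x * laplacian_psi G psi (u t) x
              + u t x * Omega_psi G psi (u t) x)
  + (2 * K * d * t ^+ 2 * laplacian G (u t) x
     + 2 * K / 3 * d * t ^+ 3 * laplacian G (laplacian G (u t)) x)
  + (n / 2 * (1 + K * t) ^+ 2 * u t x
     + n / 2 * (t + K * t ^+ 2 + K ^+ 2 / 3 * t ^+ 3) * laplacian G (u t) x).

Let v_is_derive (t : R) x : 0 <= t <= T -> is_derive t 1 (v^~ x) (dv t x).
Proof.
move=> tT; have idd := is_derive_id t (1 : R).
have powd m := is_derive_expn m idd.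
have Ld : is_derive t 1 (fun s => laplacian G (u s) x) (laplacian G (laplacian G (u t)) x).
  by apply: (@laplacian_is_derive _ _ G u (fun s => laplacian G (u s))) => y.
have d1 := is_derive_mul (powd 2) (is_derive_mul (heat_u t x) (laplacian_psi_is_derive x tT)).
have d2 := is_derive_mul (is_derive_cmul (2 * K / 3 * d) (powd 3)) Ld.
have d3 := is_derive_mul (is_derive_cmul (n / 2) (is_derive_add
  (is_derive_add idd (is_derive_cmul K (powd 2))) (is_derive_cmul (K ^+ 2 / 3) (powd 3))))
  (heat_u t x).
apply: is_derive_eq (is_derive_add (is_derive_add d1 d2) d3) _.
by rewrite /dv /=; field.
Qed.

(* Completing the square:
   [dv - laplacian v >= 2 u / n * (t * laplacian_psi u + n (1 + K t) / 2) ^ 2]. *)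
Let laplacian_v_le (t : R) x : 0 <= t <= T -> laplacian G (v t) x <= dv t x.
Proof.
move=> tT; rewrite /v laplacian_comb3 /dv.
have ux0 := u_gt0 x tT.
have := CD (fun y => u_gt0 y tT) x; rewrite /Gamma2_psi Gamma_psiE //.
set P := laplacian_psi _ _ _ x; set L := laplacian G (u t) x.
set O := Omega_psi _ _ _ _; set LP := laplacian G (fun y => u t y * _) x.
set LL := laplacian G (laplacian G _) x; set w := u t x => cd.
have cd' : 2 * w * t ^+ 2 * (n^-1 * P ^+ 2 + - K * (d * (L / w) - P))
    <= t ^+ 2 * (w * O + L * P - LP).
  have -> : t ^+ 2 * (w * O + L * P - LP)
      = 2 * w * t ^+ 2 * (2^-1 * (O + L * P / w - LP / w)).
    by field; rewrite gt_eqF.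
  by rewrite ler_wpM2l // !mulr_ge0 ?exprn_ge0 ?(ltW ux0) //; case/andP: tT.
have sq : 0 <= 2 * w / n * (t * P + n / 2 * (1 + K * t)) ^+ 2.
  by rewrite mulr_ge0 ?sqr_ge0 // divr_ge0 ?mulr_ge0 ?ltW.
rewrite -subr_ge0; rewrite -subr_ge0 in cd'.
(* This is an identity: [dv] minus the Laplacian of [v] is the square [sq] plus the slack in
   [cd']. *)
apply: le_trans (addr_ge0 sq cd') _; rewrite le_eqVlt; apply/orP; left; apply/eqP.
by field; rewrite !gt_eqF.
Qed.

(** Ratios of values of [u] stay in [eps / M, M / eps], where [psi] has a minimum [m]. As 1 belongs
    to this interval, [m - psi 1] is nonpositive, and the total rate may be replaced by its upper
    bound [D]. *)
Let laplacian_psi_ge : exists2 m : R, m <= 0 &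
  forall t x, 0 <= t <= T -> m <= laplacian_psi G psi (u t) x.
Proof.
have [T0|T0] := ltP T 0.
  exists 0 => // t x /andP[t0 tT]; have := le_trans t0 tT.
  by rewrite leNgt T0.
have [[x0 _]|noV] := pselect (exists x : V, True); last first.
  by exists 0 => // t x; case: noV; exists x.
have epsM : eps <= M.
  have T0' : 0 <= T <= T by rewrite T0 lexx.
  exact: le_trans (u_ge x0 T0') (u_le x0 T0').
have M0 := lt_le_trans eps0 epsM.
have epsM1 : eps / M <= 1 by rewrite ler_pdivrMr // mul1r.
have Meps1 : 1 <= M / eps by rewrite ler_pdivlMr // mul1r.
have [m psim] := psi_lower_bound psiC1 (divr_gt0 eps0 M0) (le_trans epsM1 Meps1).
have m1 : m - psi 1 <= 0 by rewrite subr_le0 psim // epsM1.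
exists (D * (m - psi 1)) => [|t x tT]; first by rewrite mulr_ge0_le0.
rewrite /laplacian_psi laplacianE.
apply: (@le_trans _ _ (\sum_(y <- nbrs G x) rate G x y * (m - psi 1))).
  by rewrite -mulr_suml ler_wnM2r.
rewrite big_seq [leRHS]big_seq; apply: ler_sum => y /rate_gt0 /ltW r0.
have ux0 := u_gt0 x tT; have uy0 := u_gt0 y tT.
rewrite ler_wpM2l // mulfV ?gt_eqF // lerD2r psim //; apply/andP; split.
  by rewrite ler_pM ?invr_ge0 ?(ltW eps0) ?(ltW M0) ?u_ge // lef_pV2 ?posrE ?u_le.
by rewrite ler_pM ?invr_ge0 ?(ltW uy0) ?(ltW ux0) ?u_le // lef_pV2 ?posrE ?u_ge.
Qed.

Let v_ge0 (t : R) x : 0 <= t <= T -> 0 <= v t x.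
Proof.
move=> tT; have T0 : 0 <= T by case/andP: tT; exact: le_trans.
have M0 : 0 <= M by apply: ltW; apply: lt_le_trans (u_gt0 x tT) (u_le x tT).
have [m m0 Pm] := laplacian_psi_ge.
(* The two summands control the first two terms of [v] from below; the third term is nonnegative. *)
pose B := T ^+ 2 * (M * - m) + 2 * K / 3 * d * T ^+ 3 * (2 * D * M).
have c0 : 0 <= 2 * K / 3 * d by rewrite !mulr_ge0 // ltW.
have B0 : 0 <= B.
  apply: addr_ge0; first by rewrite !mulr_ge0 ?exprn_ge0 ?oppr_ge0.
  by rewrite (mulr_ge0 (mulr_ge0 c0 (exprn_ge0 3 T0))) // !mulr_ge0.
apply: (laplacian_max_principle D0 rateD B0 v_is_derive laplacian_v_le) tT => [y|s y sT].
  by rewrite /v !expr0n /= !(mulr0, mul0r, addr0).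
have [s0 sleT] := andP sT; have uy0 := ltW (u_gt0 y sT).
have powT k : s ^+ k <= T ^+ k by rewrite lerXn2r ?nnegrE.
have Lu : - (2 * D * M) <= laplacian G (u s) y.
  rewrite lerNl (le_trans (ler_norm _)) // normrN; apply: norm_laplacian_le => // z.
  by rewrite ger0_norm ?u_le // ltW // u_gt0.
have e1 : - (T ^+ 2 * (M * - m)) <= s ^+ 2 * (u s y * laplacian_psi G psi (u s) y).
  have uP : M * m <= u s y * laplacian_psi G psi (u s) y.
    apply: le_trans (ler_wpM2l uy0 (Pm s y sT)).
    by rewrite ler_wnM2r ?u_le.
  have Mm : M * m <= 0 by rewrite mulr_ge0_le0.
  rewrite mulrN mulrN opprK; apply: le_trans (ler_wpM2l (exprn_ge0 2 s0) uP).
  by rewrite ler_wnM2r.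
have e2 : - (2 * K / 3 * d * T ^+ 3 * (2 * D * M))
    <= 2 * K / 3 * d * s ^+ 3 * laplacian G (u s) y.
  have DM : 0 <= 2 * D * M by rewrite !mulr_ge0.
  apply: le_trans (ler_wpM2l (mulr_ge0 c0 (exprn_ge0 3 s0)) Lu).
  by rewrite mulrN lerN2 ler_wpM2r // ler_wpM2l.
rewrite /B opprD /v -[leLHS]addr0 !lerD //.
by rewrite !mulr_ge0 ?addr_ge0 ?mulr_ge0 ?exprn_ge0 ?(ltW n0).
Qed.

Lemma li_yau t x : 0 < t <= T ->
  Gamma_psi G psi (u t) x / (1 + 2 * K / 3 * t) - (n / (2 * t) + n * K / 4)
  <= d * (laplacian G (u t) x / u t x).
Proof.
move=> /andP[t0 tT]; have tT' : 0 <= t <= T by rewrite ltW.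
have ux0 := u_gt0 x tT'; have b0 : 0 < 1 + 2 * K / 3 * t.
  by rewrite ltr_wpDr // !mulr_ge0 // ltW.
have := v_ge0 x tT'; rewrite /v => v0.
rewrite Gamma_psiE //.
have v1 : 0 <= laplacian_psi G psi (u t) x + 2 * K / 3 * t * (d * (laplacian G (u t) x / u t x))
   + n / 2 * (t^-1 + K + K ^+ 2 / 3 * t).
  have tu : 0 < t ^+ 2 * u t x by rewrite mulr_gt0 ?exprn_gt0.
  rewrite -(pmulr_rge0 _ tu); apply: le_trans v0 _; rewrite le_eqVlt; apply/orP; left.
  by apply/eqP; field; rewrite !gt_eqF.
rewrite lerBlDr ler_pdivrMr //.
set P := laplacian_psi _ _ _ _ in v1 *; set L := d * _ in v1 *.
(* The middle bracket is [v] divided by t^2 u. The surplus n K / 12 is the loss accepted for the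
   simpler constant n K / 4. *)
have -> : (L + (n / (2 * t) + n * K / 4)) * (1 + 2 * K / 3 * t) =
  L - P + (P + 2 * K / 3 * t * L + n / 2 * (t^-1 + K + K ^+ 2 / 3 * t)) + n * K / 12.
  by field; rewrite gt_eqF.
by rewrite -addrA lerDl addr_ge0 // divr_ge0 // mulr_ge0 // ltW.
Qed.

End li_yau.

(** * Riccati comparison and the Harnack inequality *)

(* While [q t2 + 1 / (A (t2 - t1)) < p t1], the gap [J = p t1 - q] satisfies the Riccati
   inequality [J' <= - A J ^ 2], that is [(1 / J)' >= A]. *)
Lemma riccati_harnack (R : realType) (p q dq : R -> R) (A t1 t2 : R) :
  0 < A -> t1 < t2 ->
  (forall t, t1 <= t <= t2 -> p t1 <= p t) ->
  (forall t, t1 <= t <= t2 -> is_derive t 1 q (dq t)) ->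
  (forall t, t1 <= t <= t2 -> 0 <= dq t) ->
  (forall t, t1 <= t <= t2 -> q t < p t -> A * (p t - q t) ^+ 2 <= dq t) ->
  p t1 <= q t2 + (A * (t2 - t1))^-1.
Proof.
move=> A0 t12 p_nd qd dq0 dqA; rewrite leNgt; apply/negP => gap.
have AT0 : 0 < A * (t2 - t1) by rewrite mulr_gt0 // subr_gt0.
have q_nd t : t1 <= t <= t2 -> q t <= q t2.
  move=> /andP[tt1 tt2]; apply: (is_derive_ge0_le tt2) => r /andP[tr rt2];
    [apply: qd|apply: dq0]; by rewrite rt2 (le_trans tt1).
(* Freezing [p] at [t1] avoids differentiating it; since [p t1 <= p t], the gap [J t] is at most
   [p t - q t]. *)
pose J t := p t1 - q t.
have J0 t : t1 <= t <= t2 -> 0 < J t.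
  move=> tT; rewrite subr_gt0 (le_lt_trans (q_nd t tT)) // (le_lt_trans _ gap) //.
  by rewrite lerDl invr_ge0 ltW.
have Jd t : t1 <= t <= t2 ->
    is_derive t 1 (fun s => (J s)^-1 + - A * s) (dq t / J t ^+ 2 - A).
  move=> tT; have Jt0 := lt0r_neq0 (J0 t tT).
  have dJ : is_derive t 1 J (- dq t).
    apply: is_derive_eq (is_deriveB (is_derive_cst (p t1) t 1) (qd t tT)) _.
    by rewrite sub0r.
  apply: is_derive_eq (is_derive_add (is_deriveV Jt0 dJ)
    (is_derive_cmul (- A) (is_derive_id t 1))) _.
  by rewrite /GRing.scale /=; field.
have := @is_derive_ge0_le R _ _ t1 t2 (ltW t12) Jd.
have Jd0 t : t1 <= t <= t2 -> 0 <= dq t / J t ^+ 2 - A.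
  move=> tT; have Jt0 := J0 t tT; have pJ : J t <= p t - q t by rewrite lerD2r p_nd.
  rewrite subr_ge0 ler_pdivlMr ?exprn_gt0 //.
  apply: le_trans (dqA t tT _); last by rewrite -subr_gt0 (lt_le_trans Jt0).
  by rewrite ler_wpM2l ?(ltW A0) // lerXn2r // nnegrE ltW // (lt_le_trans Jt0).
move=> /(_ Jd0).
have t1T : t1 <= t1 <= t2 by rewrite lexx ltW.
have t2T : t1 <= t2 <= t2 by rewrite lexx ltW.
have J1 : 0 < (J t1)^-1 by rewrite invr_gt0 J0.
have J2 : (J t2)^-1 < A * (t2 - t1).
  by rewrite invf_plt ?posrE ?J0 // ltrBrDl.
move=> h; move: J2; rewrite ltNge => /negP; apply; move: h J1; lra.
Qed.

Section harnack.
Context {R : realType} {V : choiceType} (G : wgraph R V) (psi : R -> R).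
Hypothesis (psiC1 : C1_pos psi) (psi_conc : concave_pos psi).
Local Notation d := (derive1 psi 1).
Implicit Types (f g : V -> R) (x y z : V).
Variables (n K T H wm mm : R) (u : R -> V -> R).
Hypothesis (d0 : 0 < d) (n0 : 0 < n) (K0 : 0 <= K) (H0 : 0 < H).
Hypothesis (wm0 : 0 < wm) (mm0 : 0 < mm).
Hypothesis (weight_ge : forall x y, adj G x y -> wm <= weight G x y).
Hypothesis (mu_le : forall x, mu G x <= mm).
Hypothesis (psiH : forall s, 1 < s -> ln s ^+ 2 <= H * psibar psi s).
Hypothesis (heat_u : forall (t : R) x, is_derive t 1 (u^~ x) (laplacian G (u t) x)).
Hypothesis (u_gt0 : forall t x, 0 < t <= T -> 0 < u t x).
Hypothesis (u_li_yau : forall t x, 0 < t <= T ->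
  Gamma_psi G psi (u t) x / (1 + 2 * K / 3 * t) - (n / (2 * t) + n * K / 4)
  <= d * (laplacian G (u t) x / u t x)).

(** The time correction compensates the negative terms of the Li-Yau inequality, so [W] is
    nondecreasing in time. It does not depend on the vertex, so differences of [W] at equal times
    are logarithms of ratios of [u]. *)
Let W (t : R) x := ln (u t x) + (n / (2 * d) * ln t + n * K / (4 * d) * t).
Let dW (t : R) x := laplacian G (u t) x / u t x + (n / (2 * d * t) + n * K / (4 * d)).
Let A := wm / (mm * H * d * (1 + 2 * K / 3 * T)).

Let beta_gt0 (t : R) : 0 < t -> 0 < 1 + 2 * K / 3 * t.
Proof. by move=> t0; rewrite ltr_wpDr // !mulr_ge0 // ltW. Qed.

Let beta3_gt0 (t : R) : 0 < t -> 0 < 3 + 2 * K * t.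
Proof. by move=> t0; rewrite ltr_wpDr // !mulr_ge0 // ltW. Qed.

Let W_is_derive (t : R) x : 0 < t <= T -> is_derive t 1 (W^~ x) (dW t x).
Proof.
move=> tT; have ux0 := u_gt0 x tT; have /andP[t0 _] := tT.
have lnu := @is_derive1_comp R (@ln R) (u^~ x) t _ _ (is_derive1_ln ux0) (heat_u t x).
apply: is_derive_eq (is_derive_add lnu (is_derive_add
  (is_derive_cmul (n / (2 * d)) (is_derive1_ln t0))
  (is_derive_cmul (n * K / (4 * d)) (is_derive_id t 1)))) _.
by rewrite /dW mulr1 [_^-1 * _]mulrC; congr (_ + (_ + _)); field; rewrite !gt_eqF.
Qed.

Let dW_ge (t : R) x : 0 < t <= T ->
  Gamma_psi G psi (u t) x / (d * (1 + 2 * K / 3 * t)) <= dW t x.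
Proof.
move=> tT; have /andP[t0 _] := tT; have := u_li_yau x tT.
rewrite lerBlDr => h; have b0 := beta_gt0 t0.
rewrite -(ler_pM2l d0); apply: le_trans (le_trans h _); rewrite le_eqVlt;
  apply/orP; left; apply/eqP;
  by rewrite /dW; field; rewrite !gt_eqF ?u_gt0 ?beta3_gt0.
Qed.

Let Gamma_ge0 (t : R) x : 0 < t <= T -> 0 <= Gamma_psi G psi (u t) x.
Proof.
move=> tT; rewrite Gamma_psi_sum ?u_gt0 // big_seq sumr_ge0 // => y /rate_gt0 /ltW r0.
by rewrite mulr_ge0 // psibar_ge0 // divr_gt0 ?u_gt0.
Qed.

Let dW_ge0 (t : R) x : 0 < t <= T -> 0 <= dW t x.
Proof.
move=> tT; apply: le_trans (dW_ge x tT); have /andP[t0 _] := tT.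
by rewrite divr_ge0 ?Gamma_ge0 // mulr_ge0 ?ltW ?beta_gt0.
Qed.

Let W_nd (t s : R) x : 0 < t -> t <= s -> s <= T -> W t x <= W s x.
Proof.
move=> t0 ts sT; apply: (@is_derive_ge0_le R (W^~ x) (dW^~ x) t s) => // r /andP[tr rs];
  [apply: W_is_derive|apply: dW_ge0]; by rewrite (lt_le_trans t0 tr) (le_trans rs).
Qed.

(** Every term of [Gamma_psi] is nonnegative, so keeping the one for [y] gives a lower bound, which
    [psiH] turns into a squared logarithm. Replacing [t] by [T] in the denominator makes [A]
    constant in time. *)
Let dW_edge (t : R) y z : adj G z y -> 0 < t <= T -> W t z < W t y ->
  A * (W t y - W t z) ^+ 2 <= dW t z.
Proof.
move=> zy tT Wzy; have /andP[t0 tleT] := tT.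
have uy0 := u_gt0 y tT; have uz0 := u_gt0 z tT.
have -> : W t y - W t z = ln (u t y / u t z).
  by rewrite ln_div ?posrE // /W; ring.
have ratio : 1 < u t y / u t z.
  by rewrite ltr_pdivlMr // mul1r -ltr_ln ?posrE //; move: Wzy; rewrite /W ltrD2r.
apply: le_trans (dW_ge z tT).
have pb := psiH ratio; set l := ln _ ^+ 2 in pb *.
have l0 : 0 <= l by exact: sqr_ge0.
have Gz : wm / mm * (l / H) <= Gamma_psi G psi (u t) z.
  rewrite Gamma_psi_sum // (bigD1_seq y) ?mem_nbrs ?finmap.fset_uniq //=.
  apply: ler_wpDr.
    rewrite big_seq_cond sumr_ge0 // => a /andP[/rate_gt0 /ltW r0 _].
    by rewrite mulr_ge0 // psibar_ge0 // divr_gt0 ?u_gt0.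
  have r0 : wm / mm <= rate G z y.
    by rewrite ler_pM ?invr_ge0 ?(ltW wm0) ?(ltW mm0) ?weight_ge // lef_pV2 ?posrE ?mu_gt0.
  by rewrite ler_pM // ?divr_ge0 ?(ltW wm0) ?(ltW mm0) ?(ltW H0) // ler_pdivrMr // mulrC.
have bt := beta_gt0 t0; have bT := beta_gt0 (lt_le_trans t0 tleT).
have X0 : 0 <= wm / mm * (l / H).
  by apply: mulr_ge0; apply: divr_ge0 => //; apply: ltW.
have -> : A * l = wm / mm * (l / H) / (d * (1 + 2 * K / 3 * T)).
  by rewrite /A; field; rewrite !gt_eqF ?beta3_gt0 // (lt_le_trans t0).
apply: ler_pM => //; first by rewrite invr_ge0 mulr_ge0 // ltW.
rewrite lef_pV2 ?posrE ?mulr_gt0 // ler_wpM2l ?(ltW d0) // lerD2l ler_wpM2l //.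
by rewrite !mulr_ge0.
Qed.

Let A_gt0 : 0 < T -> 0 < A.
Proof. by move=> T0; rewrite divr_gt0 // !mulr_gt0 // beta_gt0. Qed.

Let W_edge (t h : R) y z : adj G y z -> 0 < t -> 0 < h -> t + h <= T ->
  W t y <= W (t + h) z + (A * h)^-1.
Proof.
move=> yz t0 h0 thT.
have inT r : t <= r <= t + h -> 0 < r <= T.
  by move=> /andP[tr rth]; rewrite (lt_le_trans t0 tr) (le_trans rth).
have T0 : 0 < T by rewrite (lt_le_trans _ thT) // addr_gt0.
rewrite -[in (A * h)^-1](addKr t h) [- t + _]addrC.
apply: (riccati_harnack (A_gt0 T0) _ (p := W^~ y) (q := W^~ z) (dq := dW^~ z)).
- by rewrite ltrDl.
- by move=> r rT; have /andP[_ rleT] := inT r rT; have /andP[? _] := rT; exact: W_nd.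
- by move=> r /inT; exact: W_is_derive.
- by move=> r /inT; exact: dW_ge0.
- by move=> r /inT; apply: dW_edge; rewrite adj_sym.
Qed.

Let W_path (h : R) (p : seq V) (t : R) y : path (adj G) y p -> 0 < t -> 0 < h ->
  t + (size p)%:R * h <= T ->
  W t y <= W (t + (size p)%:R * h) (last y p) + (size p)%:R / (A * h).
Proof.
move=> + + h0; elim: p t y => [|z p IH] t y /=; first by rewrite !mul0r !addr0.
move=> /andP[yz zp] t0; rewrite -natr1 => tT.
have tE : t + ((size p)%:R + 1) * h = t + h + (size p)%:R * h by ring.
rewrite tE in tT *.
have th0 : 0 < t + h by rewrite addr_gt0.
apply: le_trans (W_edge yz t0 h0 (le_trans _ tT)) _.
  by rewrite lerDl mulr_ge0 // ltW.
rewrite mulrDl mul1r addrA lerD2r.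
exact: IH.
Qed.

Lemma harnack_dist (t : R) y z : 0 < t -> t < T ->
  u t y <= u T z * (T / t) `^ (n / (2 * d)) *
    expR (K * n * (T - t) / (4 * d)
      + d * H * mm * (3 + 2 * K * T) * (dist G y z)%:R ^+ 2 / (3 * wm * (T - t))).
Proof.
move=> t0 tT; have T0 := lt_trans t0 tT; have tT' : 0 < t <= T by rewrite t0 ltW.
have TT : 0 < T <= T by rewrite T0 lexx.
have uy0 := u_gt0 y tT'; have uz0 := u_gt0 z TT.
have Tt0 : 0 < T - t by rewrite subr_gt0.
(* A geodesic with k edges is crossed in time steps (T - t) / k. Each edge costs k / (A (T - t)),
   hence k^2 in total. *)
have WW : W t y <= W T z + (dist G y z)%:R ^+ 2 / (A * (T - t)).
  rewrite /dist; case: ex_minnP => k /asboolP[p [<- yp <-]] _.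
  (* For k = 0 there is no time step, and monotonicity of [W] in time suffices. *)
  case: p yp => [|a p] yp.
    by rewrite /= expr0n /= mul0r addr0 W_nd // ltW.
  set q := a :: p in yp *; have q0 : (0 : R) < (size q)%:R by rewrite ltr0n.
  have qh : t + (size q)%:R * ((T - t) / (size q)%:R) = T.
    by field; rewrite gt_eqF.
  have := @W_path ((T - t) / (size q)%:R) q t y yp t0.
  rewrite divr_gt0 // qh lexx => /(_ isT isT) /le_trans; apply.
  rewrite lerD2l le_eqVlt; apply/orP; left; apply/eqP; field.
  by rewrite !gt_eqF ?A_gt0.
have -> : u t y = expR (ln (u t y)) by rewrite lnK ?posrE.
rewrite -[X in X * _ * _](@lnK _ (u T z)) ?posrE //.
rewrite /powR gt_eqF ?divr_gt0 // -!expRD ler_expR ln_div ?posrE //.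
have bT := beta_gt0 T0.
have AE : (dist G y z)%:R ^+ 2 / (A * (T - t))
    = d * H * mm * (3 + 2 * K * T) * (dist G y z)%:R ^+ 2 / (3 * wm * (T - t)).
  by rewrite /A; field; rewrite !gt_eqF ?beta3_gt0.
rewrite -AE; have -> : K * n * (T - t) / (4 * d) = n * K / (4 * d) * T - n * K / (4 * d) * t.
  by field; rewrite gt_eqF.
move: WW; rewrite /W; lra.
Qed.

End harnack.

(** * Finite bounds from the extended-real constants, and the heat kernel estimate *)

Lemma mu_max_bound (R : realType) (V : choiceType) (G : wgraph R V) :
  (mu_max G < +oo)%E -> forall x, mu G x <= fine (mu_max G).
Proof.
move=> mufin x.
have mux y : ((mu G y)%:E <= mu_max G)%E by apply: ereal_sup_ubound; exists y.
have mu0 : (0 < mu_max G)%E by apply: lt_le_trans (mux x); rewrite lte_fin mu_gt0.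
by rewrite -lee_fin fineK // gt0_fin_numE.
Qed.

Lemma w_min_bound (R : realType) (V : choiceType) (G : wgraph R V) x0 y0 :
  (0 < w_min G)%E -> adj G x0 y0 ->
  0 < fine (w_min G) /\ forall x y, adj G x y -> fine (w_min G) <= weight G x y.
Proof.
move=> w0 xy0.
have wle x y : adj G x y -> (w_min G <= (weight G x y)%:E)%E.
  by move=> xy; apply: ereal_inf_lbound; exists (x, y).
have wfin : (w_min G < +oo)%E by apply: le_lt_trans (wle _ _ xy0) (ltry _).
have wE : (fine (w_min G))%:E = w_min G by rewrite fineK // gt0_fin_numE.
split=> [|x y xy]; first by rewrite fine_gt0 // w0 wfin.
by rewrite -lee_fin wE wle.
Qed.

Lemma dist_no_edge (R : realType) (V : choiceType) (G : wgraph R V) y z :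
  (forall x y, ~~ adj G x y) -> dist G y z = 0%N.
Proof.
move=> noadj; rewrite /dist; case: ex_minnP => k /asboolP[[|a p] [<- //= /andP[ya]]].
by rewrite (negbTE (noadj _ _)) in ya.
Qed.

(** An arbitrary positive lower bound [wm] stands in for [w_min], so that graphs without edges are
    covered too. *)
Lemma heat_kernel_harnack (R : realType) (V : choiceType) (G : wgraph R V)
  (psi : R -> R) (n K wm : R)
  (hD : (D_mu G < +oo)%E) (hmu : (mu_max G < +oo)%E)
  (hw : 0 < wm) (weight_ge : forall x y, adj G x y -> wm <= weight G x y)
  (hpsi : C1_pos psi) (hconc : concave_pos psi) (hpsi1 : 0 < derive1 psi 1)
  (hH : (H_psi psi < +oo)%E)
  (hn : 0 < n) (hK : 0 <= K) (hCD : CDpsi G psi n (- K))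
  (t s : R) (ht : 0 < t) (hts : t < s) (x y z : V) :
  heat_kernel G t x y <=
    heat_kernel G s x z * ((s / t) `^ (n / (2 * derive1 psi 1))) *
    expR (K * n * (s - t) / (4 * derive1 psi 1)
          + derive1 psi 1 * fine (H_psi psi) * fine (mu_max G) * (3 + 2 * K * s)
              * (dist G y z)%:R ^+ 2 / (3 * wm * (s - t))).
Proof.
have [D D0 rateD] := laplacian_bounded_degree hD.
have [H0 psiH] := H_psi_bound hpsi hconc hH.
rewrite -[leRHS]mulrA; set C := (X in heat_kernel G s x z * X).
have C0 : 0 <= C by rewrite mulr_ge0 ?powR_ge0 ?expR_ge0.
pose f z := (mu G x)^-1 * \1_[set x] z.
have f_ge0 a : 0 <= f a <= (mu G x)^-1.
  have mu0 : 0 <= (mu G x)^-1 by rewrite invr_ge0 ltW // mu_gt0.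
  rewrite /f indicE; case: (_ \in _); first by rewrite mulr1 mu0 lexx.
  by rewrite mulr0 lexx mu0.
have f_bd a : `|f a| <= (mu G x)^-1 by have /andP[f0 ?] := f_ge0 a; rewrite ger0_norm.
(* By symmetry the kernel solves the heat equation in its second vertex, the one that varies in the
   estimate. *)
have kernelE r a : heat_kernel G r x a = heat_semigroup G r f a.
  by rewrite (heat_kernelC _ _ _ rateD D0) (heat_kernelE _ _ _ rateD D0).
have eps_harnack eps : 0 < eps ->
    heat_kernel G t x y + eps <= (heat_kernel G s x z + eps) * C.
  move=> eps0; pose u r a := heat_semigroup G r f a + eps.
  have heat_u (r : R) a : is_derive r 1 (u^~ a) (laplacian G (u r) a).
    have -> : laplacian G (u r) a = laplacian G (heat_semigroup G r f) a.
      by rewrite !laplacianE; apply: eq_bigr => b _; rewrite /u; congr (_ * _); ring.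
    apply: is_derive_eq (is_derive_add (heat_is_derive D0 rateD a r f_bd)
      (is_derive_cst eps r 1)) _.
    by rewrite addr0.
  have u_ge r a : 0 <= r <= s -> eps <= u r a.
    by move=> /andP[r0 _]; rewrite /u lerDr (heat_ge0 D0 rateD a f_ge0).
  have u_le r a : 0 <= r <= s -> u r a <= (mu G x)^-1 * expR (2 * D * s) + eps.
    move=> /andP[r0 rs]; rewrite /u lerD2r (le_trans (ler_norm _)) //.
    rewrite (le_trans (norm_heat_le D0 rateD f_bd a r)) // ger0_norm //.
    by rewrite ler_wpM2l ?invr_ge0 ?(ltW (mu_gt0 _ _)) // ler_expR ler_wpM2l ?mulr_ge0.
  have posW r : 0 < r <= s -> 0 <= r <= s by move=> /andP[/ltW -> ->].
  rewrite !kernelE mulrA.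
  apply: (@harnack_dist R V G psi hpsi hconc n K s (fine (H_psi psi)) wm
    (fine (mu_max G)) u) => //.
  - by apply: lt_le_trans (mu_max_bound hmu x); exact: mu_gt0.
  - exact: mu_max_bound.
  - by move=> r a /posW rs; apply: lt_le_trans (u_ge r a rs).
  - move=> r a rs.
    exact: (li_yau hpsi D0 rateD hpsi1 hn hK hCD eps0 heat_u u_ge u_le).
(* The shift is removed by taking eps = e / (C + 1), for which eps C is at most e; adding 1 keeps
   the denominator positive. *)
apply/ler_addgt0Pr => e e0.
have C1 : 0 < C + 1 by rewrite ltr_wpDl.
have e'0 : 0 < e / (C + 1) by rewrite divr_gt0.
have := eps_harnack _ e'0; rewrite mulrDl.
have : e / (C + 1) * C <= e.
  by rewrite mulrAC ler_pdivrMr // ler_wpM2l ?(ltW e0) // lerDl.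
move: e'0; lra.
Qed.

Unset Implicit Arguments.

Theorem corollary4p7 (R : realType) (V : choiceType) (G : wgraph R V)
  (psi : R -> R) (n K : R)
  (hD : (D_mu G < +oo)%E) (hmu : (mu_max G < +oo)%E) (hw : (0 < w_min G)%E)
  (hpsi : C1_pos psi) (hconc : concave_pos psi) (hpsi1 : 0 < derive1 psi 1)
  (hH : (H_psi psi < +oo)%E)
  (hn : 0 < n) (hK : 0 <= K) (hCD : CDpsi G psi n (- K))
  (t s : R) (ht : 0 < t) (hts : t < s) (x y z : V) :
  heat_kernel G t x y <=
    heat_kernel G s x z * ((s / t) `^ (n / (2 * derive1 psi 1))) *
    expR (K * n * (s - t) / (4 * derive1 psi 1)
          + derive1 psi 1 * fine (H_psi psi) * fine (mu_max G) * (3 + 2 * K * s)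
              * (dist G y z)%:R ^+ 2
            / (3 * fine (w_min G) * (s - t))).
Proof.
have [[x0 [y0 xy0]]|noadj] := pselect (exists x0 y0, adj G x0 y0).
  have [w0 wle] := w_min_bound hw xy0.
  exact: heat_kernel_harnack.
have noadj' a b : ~~ adj G a b by apply/negP => ab; apply: noadj; exists a, b.
(* Without edges [w_min] is +oo and [fine] sends it to 0. All distances vanish as well, so the
   distance term is 0 on both sides and 1 serves as [wm]. *)
have := @heat_kernel_harnack R V G psi n K 1 hD hmu ltr01 _ hpsi hconc hpsi1 hH hn hK hCD
  t s ht hts x y z.
rewrite dist_no_edge // expr0n /= !mulr0 !mul0r; apply.
by move=> a b; rewrite (negbTE (noadj' a b)).
Qed.
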